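(* For every $k \geq 2$ and every $n \geq 2$, the DCell graph $D_{k,n}$ is not vertex-transitive.
   Context: DCell graphs $D_{k,n}$ ($k \geq 0$, $n \geq 2$) are defined recursively. $D_{0,n}$ is the complete graph $K_n$ on vertices labeled $0,1,\dots,n-1$. Let $t_{k,n}$ denote the number of vertices of $D_{k,n}$. For $k \geq 1$, $D_{k,n}$ consists of $t_{k-1,n}+1$ disjoint copies $D^i_{k-1,n}$, $i = 0,1,\dots,t_{k-1,n}$, of $D_{k-1,n}$; a vertex of $D^i_{k-1,n}$ is labeled $(i,a_{k-1},\dots,a_0)$, where $(a_{k-1},\dots,a_0)$ is its label in $D_{k-1,n}$. For a suffix $(a_j,\dots,a_0)$ define $uid_j = a_0 + \sum_{l=1}^{j} a_l\, t_{l-1,n}$. Besides the edges inside the copies, for every pair $a<b$ of copy indices there is exactly one additional edge, joining the vertex of $D^a_{k-1,n}$ whose suffix has $uid_{k-1} = b-1$ to the vertex of $D^b_{k-1,n}$ whose suffix has $uid_{k-1} = a$. A graph is vertex-transitive if its automorphism group acts transitively on its vertices. *)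

(* Defs.v *)
From HB Require Import structures.
From mathcomp Require Import all_boot all_fingroup.

Set Implicit Arguments.
Unset Strict Implicit.
Unset Printing Implicit Defensive.

(* A label (a_k, (a_{k-1}, ... (a_1, a_0))) is a right-nested tuple, so that
   the second projection is the suffix (a_{k-1}, ..., a_0). *)
Fixpoint dcell_vertex (k n : nat) : finType :=
  match k with
  | 0 => 'I_n
  | k'.+1 => ('I_(#|dcell_vertex k' n|.+1) * dcell_vertex k' n)%type
  end.

Definition dcell_card (k n : nat) : nat := #|dcell_vertex k n|.

Fixpoint dcell_uid (k n : nat) : dcell_vertex k n -> nat :=
  match k with
  | 0 => fun a => nat_of_ord a
  | k'.+1 => fun v => dcell_uid v.2 + v.1 * dcell_card k' n
  end.

(* The additional edge between copies a < b, listed with its end in copy a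
   first; "uid = b - 1" is written "uid + 1 = b". *)
Definition dcell_link (k n : nat) (u v : dcell_vertex k.+1 n) : bool :=
  [&& u.1 < v.1, (dcell_uid u.2).+1 == v.1 & dcell_uid v.2 == u.1].

Fixpoint dcell (k n : nat) : rel (dcell_vertex k n) :=
  match k with
  | 0 => fun u v => u != v
  | k'.+1 => fun u v =>
      [|| (u.1 == v.1) && dcell u.2 v.2, dcell_link u v | dcell_link v u]
  end.

Section GraphAutomorphisms.

Variables (T : finType) (e : rel T).

Definition graph_aut : {set {perm T}} :=
  [set s : {perm T} | [forall u, forall v, e (s u) (s v) == e u v]].

Lemma graph_autP (s : {perm T}) :
  reflect (forall u v, e (s u) (s v) = e u v) (s \in graph_aut).
Proof.
rewrite inE; apply: (iffP forallP) => [H u v | H u].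
  by apply/eqP; apply: (forallP (H u)).
by apply/forallP => v; apply/eqP.
Qed.

Fact graph_aut_group_set : group_set graph_aut.
Proof.
apply/group_setP; split=> [|s t /graph_autP Hs /graph_autP Ht].
  by apply/graph_autP => u v; rewrite !perm1.
by apply/graph_autP => u v; rewrite !permM Ht Hs.
Qed.

Canonical graph_aut_group : {group {perm T}} := Group graph_aut_group_set.

Definition vertex_transitive : bool :=
  [transitive graph_aut, on [set: T] | 'P].

End GraphAutomorphisms.

Lemma dcell_card0 (n : nat) : dcell_card 0 n = n.
Proof. exact: card_ord. Qed.

Lemma dcell_cardS (k n : nat) :
  dcell_card k.+1 n = (dcell_card k n).+1 * dcell_card k n.
Proof. by rewrite /dcell_card /= card_prod card_ord. Qed.

Lemma dcell_uid_lt (k n : nat) (v : dcell_vertex k n) :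
  dcell_uid v < dcell_card k n.
Proof.
elim: k v => [v|k IHk [a v]]; first by rewrite dcell_card0 ltn_ord.
rewrite dcell_cardS /=.
have: a < (dcell_card k n).+1 by exact: ltn_ord.
move=> lt_a; apply: (@leq_trans (a.+1 * dcell_card k n)).
  by rewrite mulSn -addSn leq_add2r IHk.
by rewrite leq_mul2r lt_a orbT.
Qed.

Lemma dcell_uid_inj (k n : nat) : injective (@dcell_uid k n).
Proof.
elim: k => [|k IHk]; first exact: val_inj.
move=> [a u] [b v] /= E.
have t_gt0 : 0 < dcell_card k n by apply: leq_ltn_trans (dcell_uid_lt u).
have Euv : u = v.
  apply: IHk; have := congr1 (modn^~ (dcell_card k n)) E.
  by rewrite /= ![_ + _ * _]addnC !modnMDl !modn_small ?dcell_uid_lt.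
rewrite Euv in E *; congr (_, _); apply: val_inj => /=.
by move/addnI/eqP: E; rewrite eqn_pmul2r // => /eqP.
Qed.

Lemma dcell_sym (k n : nat) : symmetric (@dcell k n).
Proof.
elim: k => [|k IHk] u v /=; first by rewrite eq_sym.
by rewrite eq_sym IHk [dcell_link u v || _]orbC.
Qed.

Lemma dcell_irr (k n : nat) : irreflexive (@dcell k n).
Proof.
elim: k => [|k IHk] u /=; first by rewrite eqxx.
by rewrite IHk /dcell_link ltnn andbF.
Qed.

(* Main.v *)
Require Import Defs.
From mathcomp Require Import all_boot.
From mathcomp Require Import all_fingroup zify.

Set Implicit Arguments.
Unset Strict Implicit.
Unset Printing Implicit Defensive.

(** Count the 6-cycles through a vertex. Two copies are joined by a single edge
    and every vertex has a single edge leaving its copy, so a 6-cycle either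
    stays inside one copy or alternates edges inside three copies with the three
    edges joining them. The copies being isomorphic, the cycles of the first
    kind are equally many through the vertices (i, 0, ..., 0) for all i.
    Through (0, 0, ..., 0) there is a cycle of the second kind, visiting copies
    0, 1, 2. Through (t, 0, ..., 0), where t = t_{k-1,n} indexes the last copy,
    there is none: it would visit copy 0 and some copy l with 0 < l < t, in which
    the vertices of uid 0 and t - 1 would have to be adjacent, and for k >= 2
    they are not. *)

Section Hexagons.

Variables (T : finType) (e : rel T).

(** A 6-cycle is listed from [x] on, so for a symmetric [e] it is counted once per direction; this
    is harmless, since the counts are only compared. *)
Definition hexagons (x : T) : {set 5.-tuple T} :=
  [set p : 5.-tuple T | path.cycle e (x :: p) && uniq (x :: p)].

Lemma leq_hexagons_aut (s : {perm T}) (x : T) :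
  s \in graph_aut e -> #|hexagons x| <= #|hexagons (s x)|.
Proof.
move=> /graph_autP es.
rewrite -(@card_imset _ _ (fun p : 5.-tuple T => [tuple of map s p])); last first.
  by move=> p q /(congr1 val) /= /(inj_map perm_inj)/val_inj.
apply/subset_leq_card/subsetP => _ /imsetP[p + ->].
rewrite !inE -map_cons (map_inj_uniq perm_inj) => /andP[cyc_p ->].
by rewrite andbT; apply: homo_cycle cyc_p => u v; rewrite es.
Qed.

End Hexagons.

Section CopyCrossings.

Variables (T C : eqType) (copy : T -> C) (inside cross : rel T).

Hypothesis inside_copy : forall u v, inside u v -> copy u = copy v.
Hypothesis cross_sym : symmetric cross.
Hypothesis cross_copy : forall u v, cross u v -> copy u <> copy v.
Hypothesis cross_uniq : forall u v w, cross u v -> cross u w -> v = w.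
Hypothesis cross_endpoint : forall u v u' v',
  cross u v -> cross u' v' -> copy u = copy u' -> copy v = copy v' -> u = u'.

(** Two consecutive crossings would give two equal vertices, so there are at most three. A single
    one could not return to its copy, and two would join the same pair of copies, hence be the same
    edge. Three must alternate with inside edges. *)
Lemma hexagon_crossings (x0 x1 x2 x3 x4 x5 : T) :
  path.cycle (relU inside cross) [:: x0; x1; x2; x3; x4; x5] ->
  uniq [:: x0; x1; x2; x3; x4; x5] ->
  [\/ all (fun z => copy z == copy x0) [:: x1; x2; x3; x4; x5],
      [&& cross x0 x1, inside x1 x2, cross x2 x3,
          inside x3 x4, cross x4 x5 & inside x5 x0]
    | [&& inside x0 x1, cross x1 x2, inside x2 x3,
          cross x3 x4, inside x4 x5 & cross x5 x0]].
Proof.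
move=> /= /and5P[/orP e01 /orP e12 /orP e23 /orP e34].
move=> /and3P[/orP e45 /orP e50 _]; rewrite !inE !negb_or.
move=> /andP[/and5P[/eqP n01 /eqP n02 /eqP n03 /eqP n04 /eqP n05]].
move=> /andP[/and4P[/eqP n12 /eqP n13 /eqP n14 /eqP n15]].
move=> /andP[/and3P[/eqP n23 /eqP n24 /eqP n25]].
move=> /andP[/andP[/eqP n34 /eqP n35]] /andP[/eqP n45 _].
have uniqS u v w : cross u v -> cross v w -> u = w.
  by rewrite cross_sym; apply: cross_uniq.
(* A cycle with just two crossings traverses them in opposite directions, hence the swapped ends. *)
have endS u v u' v' :
    cross u v -> cross u' v' -> copy u = copy v' -> copy v = copy u' -> v = u'.
  by move=> c c' E E'; apply: cross_endpoint E' E; rewrite // cross_sym.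
case: e01 => [i01|c01]; case: e12 => [i12|c12];
case: e23 => [i23|c23]; case: e34 => [i34|c34];
case: e45 => [i45|c45]; case: e50 => [i50|c50];
  try (by constructor 2; apply/and5P; split=> //; apply/andP);
  try (by constructor 3; apply/and5P; split=> //; apply/andP);
  repeat (match goal with i : is_true (inside _ _) |- _ =>
    move/inside_copy: i => i end);
  try (by constructor 1; rewrite -i45 -i34 -i23 -i12 -i01 eqxx);
  exfalso;
  try (by match goal with
     | c : is_true (cross _ _) |- _ => apply: (cross_copy c); congruence end);
  try (by match goal with
     | c : is_true (cross ?u ?v), c' : is_true (cross ?v ?w) |- _ =>
         have := uniqS _ _ _ c c'; congruence end);
  try (by match goal with
     | c : is_true (cross ?u ?v), c' : is_true (cross ?u' ?v') |- _ =>
         have E : v = u' by apply: (endS _ _ _ _ c c'); congruence end).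
Qed.

End CopyCrossings.

Section Cross.

Variables k n : nat.
Implicit Types u v w : dcell_vertex k.+1 n.

Definition inside u v := (u.1 == v.1) && dcell u.2 v.2.
Definition cross u v := dcell_link u v || dcell_link v u.

Lemma dcellS u v : dcell u v = inside u v || cross u v.
Proof. by []. Qed.

Lemma dcell_inside a (p q : dcell_vertex k n) :
  dcell p q -> @dcell k.+1 n (a, p) (a, q).
Proof. by move=> e; rewrite dcellS /inside eqxx e. Qed.

Lemma dcell_cross (a b : 'I_(dcell_card k n).+1) (p q : dcell_vertex k n) :
  a < b -> (dcell_uid p).+1 = b -> dcell_uid q = a ->
  @dcell k.+1 n (a, p) (b, q).
Proof.
move=> lt_ab Ep Eq; rewrite dcellS; apply/orP; right; apply/orP; left.
by rewrite /dcell_link lt_ab Ep Eq !eqxx.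
Qed.

Lemma inside_copy u v : inside u v -> u.1 = v.1.
Proof. by case/andP=> /eqP. Qed.

Lemma cross_sym u v : cross u v = cross v u.
Proof. exact: orbC. Qed.

Lemma cross_neq u v : cross u v -> u.1 <> v.1.
Proof.
move: u v => [a p] [b q]; rewrite /cross /dcell_link /= => + Eab.
by rewrite Eab ltnn.
Qed.

(** The vertex of uid [i] in copy [a] is linked to copy [i + 1] if [a <= i], and to copy [i]
    otherwise. *)
Lemma cross_uniq u v w : cross u v -> cross u w -> v = w.
Proof.
move: u v w => [a p] [b q] [c r]; rewrite /cross /dcell_link /= => Hv Hw.
have Ebc : b = c by apply: val_inj => /=; lia.
by rewrite Ebc in Hv *; congr (_, _); apply: dcell_uid_inj; lia.
Qed.

Lemma cross_endpoint u v u' v' :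
  cross u v -> cross u' v' -> u.1 = u'.1 -> v.1 = v'.1 -> u = u'.
Proof.
move: u v u' v' => [a p] [b q] [a' p'] [b' q'].
rewrite /cross /dcell_link /= => Huv Huv' Ea Eb; subst a' b'.
by congr (_, _); apply: dcell_uid_inj; lia.
Qed.

End Cross.

Lemma dcell_first_edge (k n : nat) : 1 < n ->
  exists w0 w1 : dcell_vertex k n,
    [/\ dcell_uid w0 = 0, dcell_uid w1 = 1 & dcell w0 w1].
Proof.
move=> n_gt1; elim: k => [|k [w0 [w1 [u0 u1 e01]]]].
  by exists (Ordinal (ltnW n_gt1)), (Ordinal n_gt1).
by exists (ord0, w0), (ord0, w1); rewrite /= u0 u1 e01.
Qed.

Lemma dcell_card_gt1 (k n : nat) : 1 < n -> 1 < dcell_card k n.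
Proof.
by move=> /(@dcell_first_edge k)[_ [w1 [_ <- _]]]; apply: dcell_uid_lt.
Qed.

(** With [t = dcell_card k n], [u] lies in copy 0 and [v] in copy [t]. The only edge between these
    copies leaves copy 0 at uid [t - 1], which is not 0. *)
Lemma dcell_first_last (k n : nat) (u v : dcell_vertex k.+1 n) :
  1 < n -> dcell_uid u = 0 -> (dcell_uid v).+1 = dcell_card k.+1 n ->
  ~~ dcell u v.
Proof.
move=> /(dcell_card_gt1 k) t_gt1; move: u v => [a p] [b q].
rewrite dcell_cardS dcellS /inside /cross /dcell_link -val_eqE /=.
move: (dcell_uid_lt p) (dcell_uid_lt q) (ltn_ord a) (ltn_ord b).
move: (nat_of_ord a) (nat_of_ord b) (dcell_uid p) (dcell_uid q) => a' b' p' q'.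
move: t_gt1; rewrite -/(dcell_card k n); move: (dcell_card k n) => t.
move=> t_gt1 lt_p lt_q lt_a lt_b Eu Ev.
have a0 : a' = 0 by nia.
have bt : b' = t by nia.
by rewrite a0 bt; lia.
Qed.

(** The uid of [x0] sends [x1] to copy 0. So [x3], reached from copy 0, has uid 0, and [x4], linked
    to the last copy, has the largest uid: [dcell_first_last] forbids the edge between them. *)
Lemma no_cross_hexagon (k n : nat) (x0 x1 x2 x3 x4 x5 : dcell_vertex k.+2 n) :
  1 < n -> x0.1 = ord_max -> @dcell_uid k.+1 n x0.2 = 0 ->
  cross x0 x1 -> x1.1 = x2.1 -> cross x2 x3 -> x3.1 = x4.1 ->
  @dcell k.+1 n x3.2 x4.2 -> cross x4 x5 -> x5.1 = x0.1 -> False.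
Proof.
move=> n_gt1 E0 U0; rewrite /cross /dcell_link U0 => H01 E12 H23 E34 e34 H45 E50.
rewrite -E12 E34 in H23; rewrite E50 E0 in H45; rewrite E0 in H01.
have := dcell_card_gt1 k.+1 n_gt1; have := ltn_ord x4.1.
move: (dcell_first_last (u := x3.2) (v := x4.2) n_gt1); rewrite e34.
move: H01 H23 H45; rewrite /= -/(dcell_card k.+1 n) => H01 H23 H45 H lt4 t_gt1.
suff: false by []; apply: H; lia.
Qed.

Lemma last_copy_hexagon (k n : nat) (w : dcell_vertex k.+1 n)
    (p : 5.-tuple (dcell_vertex k.+2 n)) :
  1 < n -> dcell_uid w = 0 ->
  p \in hexagons (@dcell k.+2 n) (ord_max, w) ->
  all (fun z => z.1 == ord_max) p.
Proof.
move=> n_gt1 Uw; rewrite inE => /andP[].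
case/tupleP: p => x1 p; case/tupleP: p => x2 p; case/tupleP: p => x3 p.
case/tupleP: p => x4 p; case/tupleP: p => x5 p; rewrite tuple0.
move=> cyc_p uniq_p.
have [//| |] := hexagon_crossings (@inside_copy k.+1 n) (@cross_sym k.+1 n)
  (@cross_neq k.+1 n) (@cross_uniq k.+1 n) (@cross_endpoint k.+1 n) cyc_p uniq_p.
- case/and5P=> c01 /inside_copy E12 c23 i34 /andP[c45 /inside_copy E50].
  case/andP: i34 => /eqP E34 e34.
  by case: (no_cross_hexagon (x0 := (ord_max, w)) n_gt1 erefl Uw c01 E12 c23
    E34 e34 c45 E50).
case/and5P=> /inside_copy E01 c12 i23 c34 /andP[/inside_copy E45 c50].
(* Read backwards from [x0], this alternation becomes the previous one. *)
rewrite cross_sym in c50; rewrite cross_sym in c34; rewrite cross_sym in c12.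
case/andP: i23 => /eqP E23 e23; rewrite dcell_sym in e23.
by case: (no_cross_hexagon (x0 := (ord_max, w)) n_gt1 erefl Uw c50 (esym E45)
  c34 (esym E23) e23 c12 (esym E01)).
Qed.

(** Replacing the copy index by 0 injects the hexagons on the left, which stay in the last copy,
    into those on the right; the image misses any hexagon that leaves copy 0. *)
Lemma ltn_hexagons_last_first (k n : nat) (w : dcell_vertex k.+1 n) :
  1 < n -> dcell_uid w = 0 ->
  #|hexagons (@dcell k.+2 n) (ord_max, w)|
    < #|hexagons (@dcell k.+2 n) (ord0, w)|.
Proof.
move=> n_gt1 Uw.
pose f (z : dcell_vertex k.+2 n) : dcell_vertex k.+2 n := (ord0, z.2).
have f_inj : {in [pred z | z.1 == ord_max] &, injective f}.
  by move=> [a u] [b v]; rewrite !inE /= => /eqP-> /eqP-> [->].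
have f_mono : {in [pred z | z.1 == ord_max] &,
    {homo f : u v / dcell u v >-> dcell u v}}.
  move=> [a u] [b v]; rewrite !inE => /eqP Ea /eqP Eb.
  rewrite dcellS => /orP[/andP[_ e]|/cross_neq []]; last by rewrite Ea Eb.
  exact: dcell_inside e.
pose F (p : 5.-tuple (dcell_vertex k.+2 n)) := [tuple of map f p].
have in_last p : p \in hexagons (@dcell k.+2 n) (ord_max, w) ->
    all [pred z | z.1 == ord_max] ((ord_max, w) :: p).
  by move=> Hp; rewrite /= eqxx; apply: last_copy_hexagon Hp.
have F_inj : {in hexagons (@dcell k.+2 n) (ord_max, w) &, injective F}.
  move=> p q /in_last /andP[_ Hp] /in_last /andP[_ Hq] E.
  by move/(congr1 val): E => /(inj_in_map f_inj Hp Hq)/val_inj.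
rewrite -(card_in_imset F_inj); apply/proper_card/properP; split.
  apply/subsetP => _ /imsetP[p Hp ->]; have lastp := in_last _ Hp.
  move: Hp; rewrite !inE -[_ :: F p]/(map f ((ord_max, w) :: p)).
  rewrite map_inj_in_uniq; last first.
    by move=> x y /(allP lastp) Px /(allP lastp) Py; apply: f_inj Px Py.
  by move=> /andP[cyc_p ->]; rewrite andbT (homo_cycle_in f_mono lastp cyc_p).
have [w0 [w1 [U0 U1 e01]]] := dcell_first_edge k.+1 n_gt1.
have {U0} Ew : w0 = w by apply: dcell_uid_inj; rewrite U0.
subst w0; have t_gt1 := dcell_card_gt1 k.+1 n_gt1.
pose c1 : 'I_(dcell_card k.+1 n).+1 :=
  Ordinal (ltnW t_gt1 : 1 < (dcell_card k.+1 n).+1).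
pose c2 : 'I_(dcell_card k.+1 n).+1 :=
  Ordinal (t_gt1 : 2 < (dcell_card k.+1 n).+1).
(* The links 0-1, 1-2 and 2-0 have end uids (0, 0), (1, 1) and (0, 1); the edge from [w] to [w1]
   closes the gap in each copy. *)
exists [tuple (c1, w); (c1, w1); (c2, w1); (c2, w); (ord0, w1)].
  rewrite inE; apply/andP; split; last first.
    apply: (@map_uniq _ _ (fun z : dcell_vertex k.+2 n =>
      (nat_of_ord z.1, @dcell_uid k.+1 n z.2))).
    rewrite -[map _ _]/[:: (0, dcell_uid w); (1, dcell_uid w); (1, dcell_uid w1);
      (2, dcell_uid w1); (2, dcell_uid w); (0, dcell_uid w1)].
    by rewrite Uw U1.
  have e10 := e01; rewrite dcell_sym in e10.
  have e0 : @dcell k.+2 n (ord0, w) (c1, w) by apply: dcell_cross; rewrite ?Uw.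
  have e2 : @dcell k.+2 n (c1, w1) (c2, w1) by apply: dcell_cross; rewrite ?U1.
  have e4 : @dcell k.+2 n (c2, w) (ord0, w1).
    by rewrite dcell_sym; apply: dcell_cross; rewrite ?Uw ?U1.
  have [e1 e3 e5] : [/\ @dcell k.+2 n (c1, w) (c1, w1),
      @dcell k.+2 n (c2, w1) (c2, w) & @dcell k.+2 n (ord0, w1) (ord0, w)].
    by split; apply: dcell_inside.
  by move: (@dcell k.+2 n) e0 e1 e2 e3 e4 e5 => e /= -> -> -> -> -> ->.
(* Tuples in the image start in copy 0, this one in copy 1. *)
apply/imsetP => -[p _ /(congr1 (fun r : 5.-tuple _ => (thead r).1))].
by case/tupleP: p.
Qed.

Theorem theorem7 (k n : nat) (hk : 2 <= k) (hn : 2 <= n) :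
  ~~ vertex_transitive (@dcell k n).
Proof.
case: k hk => [|[|k]] // _.
have [w [_ [Uw _ _]]] := dcell_first_edge k.+1 hn.
apply/negP => /atransP2 trans.
have [s aut_s E] := trans (ord0, w) (ord_max, w) (in_setT _) (in_setT _).
have := leq_hexagons_aut (ord0, w) aut_s.
by rewrite -[s _]E leqNgt ltn_hexagons_last_first.
Qed.
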